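(* Let $p$ be a fixed prime. Fix $\epsilon > 0$, an integer $r > 0$, and a partition-regular arithmetic pattern $\mathcal{H} = (\mathcal{L}, \mathcal{X})$ of complexity 1 over $\mathbb{F}_p$, where $\mathcal{X}$ is a collection of $r$-colourings. There exists a $\delta = \delta(\epsilon, r, \mathcal{H}) > 0$ (not depending on $n$ or on $\phi$) satisfying the following. For every $n$ and every $r$-colouring $\phi: \mathbb{F}_p^n \to [r]$, if the density of instances of $\mathcal{H}$ under $\phi$ satisfies $\Lambda_{\mathcal{H}}(\phi) \leq \delta$, then $\phi$ can be made $\mathcal{H}$-free by recolouring at most an $\epsilon$-proportion of $\mathbb{F}_p^n$; that is, there is a colouring $\phi' : \mathbb{F}_p^n \to [r]$ that differs from $\phi$ at no more than $\epsilon |\mathbb{F}_p^n|$ points and under which there are no instances of $\mathcal{H}$.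
   Context: Write $[k] = \{1, \ldots, k\}$. Arithmetic patterns. An arithmetic pattern $\mathcal{H}$ in $\ell$ variables is a pair $(\mathcal{L}, \mathcal{X})$, where $\mathcal{L} = \{L_1, \ldots, L_m\}$ is a collection of linear forms $L_i(\underline{x}) = c^{(i)}_1 x_1 + \cdots + c^{(i)}_\ell x_\ell$ in $\ell$ variables with coefficients in $\mathbb{F}_p$ (also called a linear system), and $\mathcal{X}$ is a collection (set) of maps $\chi : [m] \to [r]$. The forms $L_i$ are evaluated on tuples $\underline{x} \in (\mathbb{F}_p^n)^\ell$. Given an $r$-colouring $\phi: \mathbb{F}_p^n \to [r]$, an instance of $\mathcal{H}$ under $\phi$ is a tuple $\underline{x} \in (\mathbb{F}_p^n)^\ell$ such that for some $\chi \in \mathcal{X}$, $\phi(L_j(\underline{x})) = \chi(j)$ for every $1 \leq j \leq m$. The colouring $\phi$ is $\mathcal{H}$-free if there are no instances of $\mathcal{H}$ under $\phi$. Density. For $f_1, \ldots, f_m : \mathbb{F}_p^n \to [-1,1]$, let $\Lambda_{\mathcal{L}}(f_1, \ldots, f_m) = \mathbb{E}_{\underline{x} \in (\mathbb{F}_p^n)^\ell} f_1(L_1(\underline{x})) \cdots f_m(L_m(\underline{x}))$, where $\mathbb{E}$ denotes the uniform average. The density of $\mathcal{H}$ under $\phi$ is $\Lambda_{\mathcal{H}}(\phi) = \sum_{\chi \in \mathcal{X}} \Lambda_{\mathcal{L}}(\mathbb{1}_{\phi^{-1}(\chi(1))}, \ldots, \mathbb{1}_{\phi^{-1}(\chi(m))})$.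 Partition regularity. A linear system $\mathcal{L} = \{L_1, \ldots, L_m\}$ over $\mathbb{F}_p$ is partition-regular if for any $s \in \mathbb{N}$ there exists $N = N(s, p, m)$ such that, if $n \geq N$, then under any $s$-colouring of the space there is a monochromatic instance of $\mathcal{L}$ in $\mathbb{F}_p^n \setminus \{0\}$, i.e. a tuple $\underline{x} \in (\mathbb{F}_p^n)^\ell$ such that $L_1(\underline{x}), \ldots, L_m(\underline{x})$ are all non-zero and all have the same colour. A pattern $(\mathcal{L}, \mathcal{X})$ is partition-regular if $\mathcal{L}$ is. Complexity 1. For $F : \mathbb{F}_p^n \to \mathbb{C}$ and $\eta \in \mathbb{F}_p^n$ let $\widehat{F}(\eta) = \mathbb{E}_{x \in \mathbb{F}_p^n} F(x) e^{2\pi i \eta^T x / p}$. The linear system $\mathcal{L}$ has (true) complexity 1 if for every $\delta > 0$ there is an $\epsilon_{count}(\delta) > 0$ such that for all $n$ and any $F_1, \ldots, F_m : \mathbb{F}_p^n \to [-1,1]$ with $\min_i \max_{\eta \in \mathbb{F}_p^n} |\widehat{F_i}(\eta)| \leq \epsilon_{count}(\delta)$, one has $|\Lambda_{\mathcal{L}}(F_1, \ldots, F_m)| \leq \delta$. A pattern $(\mathcal{L}, \mathcal{X})$ has complexity 1 if $\mathcal{L}$ does. *)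

(* Defs.v *)
From HB Require Import structures.
From mathcomp Require Import all_boot all_order all_algebra.
From mathcomp Require Import reals trigo.
From mathcomp Require Import complex.

Set Implicit Arguments.
Unset Strict Implicit.
Unset Printing Implicit Defensive.

Import Order.TTheory GRing.Theory Num.Theory.
Local Open Scope ring_scope.

Definition average (K : fieldType) (T : finType) (f : T -> K) : K :=
  (\sum_(x : T) f x) / #|T|%:R.

(* A system of m linear forms in l variables is stored as its coefficient
   matrix: row i holds the coefficients of the i-th form. *)
Definition linear_form (p m l n : nat) (L : 'M['F_p]_(m, l)) (i : 'I_m)
    (x : {ffun 'I_l -> 'rV['F_p]_n}) : 'rV['F_p]_n :=
  \sum_(k < l) L i k *: x k.

Record pattern (p m l r : nat) := Pattern {
  forms : 'M['F_p]_(m, l);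
  patcolourings : {set {ffun 'I_m -> 'I_r}}
}.

Definition is_instance (p m l r n : nat) (H : pattern p m l r)
    (phi : {ffun 'rV['F_p]_n -> 'I_r}) (x : {ffun 'I_l -> 'rV['F_p]_n}) : Prop :=
  exists2 chi : {ffun 'I_m -> 'I_r}, chi \in patcolourings H
    & forall j : 'I_m, phi (linear_form (forms H) j x) = chi j.

Definition pattern_free (p m l r n : nat) (H : pattern p m l r)
    (phi : {ffun 'rV['F_p]_n -> 'I_r}) : Prop :=
  forall x : {ffun 'I_l -> 'rV['F_p]_n}, ~ is_instance H phi x.

Definition Lambda (R : realType) (p m l n : nat) (L : 'M['F_p]_(m, l))
    (f : 'I_m -> 'rV['F_p]_n -> R) : R :=
  average (fun x : {ffun 'I_l -> 'rV['F_p]_n} =>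
             \prod_(i < m) f i (linear_form L i x)).

Definition pattern_density (R : realType) (p m l r n : nat)
    (H : pattern p m l r) (phi : {ffun 'rV['F_p]_n -> 'I_r}) : R :=
  \sum_(chi in patcolourings H)
    Lambda (forms H) (fun (j : 'I_m) (x : 'rV['F_p]_n) => (phi x == chi j)%:R).

Definition partition_regular (p m l : nat) (L : 'M['F_p]_(m, l)) : Prop :=
  forall s : nat, exists N : nat, forall n : nat, (N <= n)%N ->
    forall psi : {ffun 'rV['F_p]_n -> 'I_s},
    exists x : {ffun 'I_l -> 'rV['F_p]_n},
      (forall i : 'I_m, linear_form L i x != 0) /\
      (forall i j : 'I_m, psi (linear_form L i x) = psi (linear_form L j x)).

(* The angle uses the representative of eta^T x in {0, ..., p - 1}. *)
Definition character (R : realType) (p n : nat) (eta x : 'rV['F_p]_n) : R[i] :=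
  let t : R := 2 * pi * (nat_of_ord ((x *m eta^T) 0 0))%:R / p%:R in
  Complex (cos t) (sin t).

Definition fourier (R : realType) (p n : nat) (F : 'rV['F_p]_n -> R[i])
    (eta : 'rV['F_p]_n) : R[i] :=
  average (fun x : 'rV['F_p]_n => F x * character R eta x).

(* "min over i of the max over eta is at most eps" is unfolded into
   "for some i, every eta satisfies the bound". *)
Definition complexity1 (R : realType) (p m l : nat) (L : 'M['F_p]_(m, l)) :
    Prop :=
  forall delta : R, 0 < delta -> exists2 eps : R, 0 < eps &
    forall (n : nat) (F : 'I_m -> 'rV['F_p]_n -> R),
      (forall i x, -1 <= F i x <= 1) ->
      (exists i : 'I_m, forall eta : 'rV['F_p]_n,
         `|fourier (fun x => (F i x)%:C%C) eta| <= eps%:C%C) ->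
      `|Lambda L F| <= delta.

(* Main.v *)
(* Write V = F_p^n.  Choose a subspace W of bounded codimension and a subspace
   W' = XW of W whose energy exceeds that of W by very little, while the colour
   densities on almost every coset of W' barely change on passing to any
   subspace of bounded codimension in W'.  Identify V/W with F_p^k by
   coordinates a; a random linear Z places at every nonzero a one coset
   aS + aZW + W' on which this regularity holds, and typically its colour
   densities are those of aS + W.  The coset a = 0 cannot be moved off 0.  There
   one chooses W'' = X'W' of bounded codimension in W' and a random linear map
   F_p^N -> W' sending all z != 0 to regular cosets of W''; partition regularity,
   applied to the most popular colours of these cosets, gives x in (F_p^N)^l
   such that all L_i(x) are nonzero and get one colour c0.
   Recolour W by c0, and outside W replace the colours that are rare on the
   chosen coset.  If y were an instance afterwards, translating the chosen cosets
   along y by the image of x would give cosets of W'' that are all regular and on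
   which all the required colours are dense, so complexity 1 would give many
   instances of the original colouring. *)
Require Import Defs.
From mathcomp Require Import all_boot all_order all_algebra.
From mathcomp Require Import boolp reals trigo complex.
From mathcomp Require Import ring lra zify.

Set Implicit Arguments.
Unset Strict Implicit.
Unset Printing Implicit Defensive.

Import Order.TTheory GRing.Theory Num.Theory.
Local Open Scope ring_scope.

(** * Averages *)

Section AverageNum.
Variables (K : numFieldType) (T : finType).
Implicit Types (f g : T -> K).

Lemma eq_average f g : f =1 g -> average f = average g.
Proof. by move=> fg; rewrite /average (eq_bigr g). Qed.

Lemma average_inj (s : T -> T) f : injective s ->
  average (fun x => f (s x)) = average f.
Proof. by move=> s_inj; rewrite /average [in RHS](reindex_inj s_inj). Qed.

Lemma averageD f g : average (fun x => f x + g x) = average f + average g.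
Proof. by rewrite /average big_split mulrDl. Qed.

Lemma averageZ (c : K) f : average (fun x => c * f x) = c * average f.
Proof. by rewrite /average -mulr_sumr mulrA. Qed.

Lemma averageN f : average (fun x => - f x) = - average f.
Proof. by rewrite /average sumrN mulNr. Qed.

Lemma averageB f g : average (fun x => f x - g x) = average f - average g.
Proof. by rewrite averageD averageN. Qed.

Lemma average_sum (I : finType) (P : pred I) (f : I -> T -> K) :
  average (fun x => \sum_(i | P i) f i x) = \sum_(i | P i) average (f i).
Proof. by rewrite /average exchange_big /= mulr_suml. Qed.

Lemma average_exchange (T' : finType) (f : T -> T' -> K) :
  average (fun x => average (f x)) = average (fun y => average (f^~ y)).
Proof.
rewrite /average -!mulr_suml exchange_big /= -!mulrA; congr (_ * _).
exact: mulrC.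
Qed.

Lemma ler_average f g : (forall x, f x <= g x) -> average f <= average g.
Proof.
by move=> fg; rewrite ler_wpM2r ?invr_ge0 ?ler0n //; apply: ler_sum.
Qed.

Lemma average_ge0 f : (forall x, 0 <= f x) -> 0 <= average f.
Proof. by move=> f0; rewrite divr_ge0 ?ler0n ?sumr_ge0. Qed.

Lemma average_norm f : `|average f| <= average (fun x => `|f x|).
Proof.
by rewrite normrM normfV normr_nat ler_wpM2r ?invr_ge0 ?ler0n ?ler_norm_sum.
Qed.

Lemma average_cst (x0 : T) (c : K) : average (fun _ : T => c) = c.
Proof.
rewrite /average sumr_const -[c *+ _]mulr_natr mulfK //.
by rewrite pnatr_eq0 -lt0n; apply/card_gt0P; exists x0.
Qed.

Lemma average_ge_point (x0 : T) f : (forall x, 0 <= f x) ->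
  f x0 / #|T|%:R <= average f.
Proof.
move=> f0; rewrite ler_wpM2r ?invr_ge0 ?ler0n // (bigD1 x0) //=.
by rewrite lerDl sumr_ge0.
Qed.

End AverageNum.

Section AverageReal.
Variables (R : realFieldType) (T : finType).
Implicit Types (f g : T -> R).

Lemma average_lt_exists (x0 : T) f (c : R) : average f < c -> exists x, f x < c.
Proof.
move=> fc; apply/existsP; apply: contraTT fc; rewrite negb_exists -leNgt.
move=> /forallP cf; rewrite -[c in c <= _](average_cst x0); apply: ler_average.
by move=> x; rewrite leNgt.
Qed.

Lemma average_sqr (x0 : T) f : average f ^+ 2 <= average (fun x => f x ^+ 2).
Proof.
have : 0 <= average (fun x => (f x - average f) ^+ 2).
  by apply: average_ge0 => x; rewrite sqr_ge0.
rewrite (eq_average (g := fun x => (f x ^+ 2 - (average f *+ 2) * f x)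
   + average f ^+ 2)); last by move=> x; rewrite sqrrB; ring.
rewrite averageD averageB averageZ average_cst //; nra.
Qed.

End AverageReal.

Section Averages.
Variables (K : numFieldType) (F : finFieldType).

Lemma average_shift m n (t : 'M[F]_(m, n)) (f : 'M[F]_(m, n) -> K) :
  average (fun x => f (x + t)) = average f.
Proof. by apply: average_inj; apply: addIr. Qed.

(** Translating [v] by [a *m S] shifts [v *m C] by [a], so averaging over [a] as well makes the
    argument of [h] uniform. *)
Lemma average_mulmx n k (C : 'M[F]_(n, k)) (S : 'M_(k, n)) (h : 'rV_k -> K) :
  S *m C = 1%:M -> average (fun v : 'rV_n => h (v *m C)) = average h.
Proof.
move=> SC; rewrite -(average_cst (0 : 'rV[F]_n) (average h)).
transitivity (average (fun a : 'rV[F]_k => average (fun v : 'rV_n => h (v *m C)))).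
  by rewrite average_cst //; exact: 0.
transitivity (average (fun a : 'rV[F]_k => average (fun v : 'rV_n => h (a + v *m C)))).
  apply: eq_average => a; rewrite -(average_shift (a *m S)).
  by apply: eq_average => v; rewrite mulmxDl -mulmxA SC mulmx1 addrC.
rewrite [LHS]average_exchange; apply: eq_average => v /=.
exact: (average_shift (v *m C) h).
Qed.

(** Some column [y] has [a *m y = 1], so translating [Z] by [y *m w] shifts [a *m Z] by an arbitrary
    [w]. *)
Lemma average_row_mulmx k n (a : 'rV[F]_k) (h : 'rV_n -> K) : a != 0 ->
  average (fun Z : 'M_(k, n) => h (a *m Z)) = average h.
Proof.
move=> /rV0Pn[j aj].
pose y : 'cV[F]_k := (a 0 j)^-1 *: delta_mx j 0.
have ay : a *m y = 1%:M.
  rewrite -scalemxAr -colE; apply/matrixP=> i i'; rewrite !ord1 !mxE eqxx.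
  by rewrite mulVf.
rewrite -(average_cst (0 : 'M[F]_(k, n)) (average h)).
transitivity (average (fun w : 'rV[F]_n =>
    average (fun Z : 'M_(k, n) => h (w + a *m Z)))).
  rewrite -[LHS](average_cst (0 : 'rV[F]_n)); apply: eq_average => w.
  rewrite -(average_shift (y *m w)); apply: eq_average => Z.
  by rewrite mulmxDr mulmxA ay mul1mx addrC.
rewrite [LHS]average_exchange; apply: eq_average => Z; exact: (average_shift (a *m Z) h).
Qed.

End Averages.

(** * Subspaces and energy *)

Section Cosets.
Variables (R : realFieldType) (F : finFieldType) (n : nat).
Implicit Types (f g : 'rV[F]_n -> R) (W D X : 'M[F]_n) (u v w : 'rV[F]_n).

(* A subspace of [F ^ n] is the row space of a square matrix [W]; averaging over
   all [w] of [w *m W] is averaging over that subspace, whatever the rank. *)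
Definition coset_average f W v : R := average (fun w => f (v + w *m W)).

Definition codim W : nat := n - \rank W.

Lemma coset_average_shift f W v u :
  coset_average f W (v + u *m W) = coset_average f W v.
Proof.
rewrite /coset_average -[RHS](average_shift u); apply: eq_average => w.
by rewrite mulmxDl -addrA [w *m W + _]addrC.
Qed.

(** Tower property: translating [u] by [w *m D] absorbs the inner shift. *)
Lemma coset_average_mul f D W v :
  average (fun u => coset_average f (D *m W) (v + u *m W)) =
  coset_average f W v.
Proof.
rewrite /coset_average average_exchange.
transitivity (average (fun _ : 'rV[F]_n => coset_average f W v)).
  apply: eq_average => w; rewrite /coset_average -[RHS](average_shift (w *m D)).
  by apply: eq_average => u; rewrite mulmxDl -mulmxA addrA.
by rewrite average_cst //; exact: 0.
Qed.

Lemma average_coset_average f W : average (coset_average f W) = average f.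
Proof.
rewrite /coset_average average_exchange -[RHS](average_cst (0 : 'rV[F]_n)).
by apply: eq_average => w; rewrite average_shift.
Qed.

Lemma codim_mul D W : (codim (D *m W) <= codim D + codim W)%N.
Proof.
rewrite /codim; have := mxrank_mul_min D W.
have := rank_leq_row D; have := rank_leq_row W.
move: (\rank W) (\rank D) (\rank (D *m W)) => a b c; lia.
Qed.

Lemma codim_cap D W : (codim (D :&: W)%MS <= codim D + codim W)%N.
Proof.
rewrite /codim; have := mxrank_sum_cap D W.
have := rank_leq_row D; have := rank_leq_row W.
have := rank_leq_col (D + W)%MS.
move: (\rank W) (\rank D) (\rank (D + W)) (\rank (D :&: W)) => a b c d; lia.
Qed.

Lemma codim_bigcap (I : finType) (D : I -> 'M[F]_n) :
  (codim (\bigcap_i D i)%MS <= \sum_i codim (D i))%N.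
Proof.
elim/big_rec2: _ => [|i d W _ IH]; first by rewrite /codim mxrank1 subnn.
by apply: leq_trans (codim_cap _ _) _; rewrite leq_add2l.
Qed.

(** [C] gives coordinates on the quotient by [W], and [S] picks coset representatives. A column
    basis of the cokernel of [W] has exactly [codim W] columns and a left inverse. *)
Lemma coset_section W : exists C : 'M[F]_(n, codim W),
  exists S : 'M[F]_(codim W, n),
  [/\ S *m C = 1%:M, W *m C = 0 & forall v, exists w, v = v *m C *m S + w *m W].
Proof.
rewrite /codim -mxrank_coker.
exists (col_base (cokermx W)), (pinvmx (col_base (cokermx W))).
set C := col_base _; set S := pinvmx _.
have SC : S *m C = 1%:M by rewrite mulVpmx // col_base_full.
have C0 m (A : 'M_(m, n)) : A *m cokermx W = 0 -> A *m C = 0.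
  rewrite -[X in _ *m X](mulmx_base (cokermx W)) mulmxA => AC0.
  by apply: (row_free_inj (row_base_free (cokermx W))); rewrite AC0 mul0mx.
split=> // [|v]; first by rewrite C0 // mulmx_coker.
have : (v - v *m C *m S <= W)%MS.
  rewrite submxE -[X in _ *m X](mulmx_base (cokermx W)) mulmxA mulmxBl.
  by rewrite -(mulmxA _ S C) SC mulmx1 subrr mul0mx.
by case/submxP=> w vw; exists w; rewrite -vw addrC subrK.
Qed.

Section Labels.
Variables (W : 'M[F]_n) (k : nat) (C : 'M[F]_(n, k)) (S : 'M[F]_(k, n)).
Hypotheses (SC : S *m C = 1%:M) (WC : W *m C = 0).
Hypothesis sectionP : forall v, exists w, v = v *m C *m S + w *m W.

Lemma coset_average_label f v :
  coset_average f W v = coset_average f W (v *m C *m S).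
Proof. by have [w {1}->] := sectionP v; rewrite coset_average_shift. Qed.

Lemma average_by_label f :
  average f = average (fun a : 'rV_k => coset_average f W (a *m S)).
Proof.
rewrite -(average_coset_average f W).
rewrite -(average_mulmx (fun a => coset_average f W (a *m S)) SC).
by apply: eq_average => v; apply: coset_average_label.
Qed.

Lemma label_coset a w : (a *m S + w *m W) *m C = a.
Proof. by rewrite mulmxDl -mulmxA SC mulmx1 -mulmxA WC mulmx0 addr0. Qed.

End Labels.

(** The cosets of [W] have equal weight, and there are at most [#|F| ^ k] of them. *)
Lemma average_ge_coset f W u k : (codim W <= k)%N -> (forall v, 0 <= f v) ->
  coset_average f W u / #|F|%:R ^+ k <= average f.
Proof.
move=> Wk f0; have [C [S [SC WC secP]]] := coset_section W.
rewrite (average_by_label SC secP) (coset_average_label secP).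
have fW a : 0 <= coset_average f W (a *m S) by apply: average_ge0.
apply: le_trans (average_ge_point (u *m C) fW).
rewrite ler_wpM2l // card_mx mul1n natrX lef_pV2 ?posrE ?exprn_gt0 ?ltr0n //.
- by rewrite ler_weXn2l // ler1n; apply/card_gt0P; exists 0.
- by apply/card_gt0P; exists 0.
- by apply/card_gt0P; exists 0.
Qed.

Section Energy.
Variables (I : finType) (f : I -> 'rV[F]_n -> R).

(** The mean-square index of the partition into cosets of [W], the potential of energy increment
    arguments. *)
Definition energy W : R :=
  \sum_i average (fun v => coset_average (f i) W v ^+ 2).

(** Pythagoras: averaging over cosets is an orthogonal projection, and the one for [W] factors
    through the one for [D *m W]. *)
Lemma energy_gain D W : energy (D *m W) - energy W =
  \sum_i average (fun v =>
    (coset_average (f i) (D *m W) v - coset_average (f i) W v) ^+ 2).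
Proof.
rewrite /energy -sumrB; apply: eq_bigr => i _.
set a := coset_average (f i) (D *m W); set b := coset_average (f i) W.
have ab : average (fun v => a v * b v) = average (fun v => b v ^+ 2).
  rewrite -(average_coset_average _ W); apply: eq_average => v.
  transitivity (average (fun u => b v * a (v + u *m W))).
    by apply: eq_average => u; rewrite mulrC /b coset_average_shift.
  by rewrite averageZ coset_average_mul expr2.
rewrite (eq_average (f := fun v => (a v - b v) ^+ 2)
  (g := fun v => a v ^+ 2 - 2 * (a v * b v) + b v ^+ 2)); last first.
  by move=> v; ring.
by rewrite averageD averageB averageZ ab; ring.
Qed.

Lemma energy_le_card W : (forall i v, 0 <= f i v <= 1) -> energy W <= #|I|%:R.
Proof.
move=> f01; rewrite -sumr_const -[X in _ <= X]/(\sum_i 1) ler_sum // => i _.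
rewrite -[X in _ <= X](average_cst (0 : 'rV[F]_n)); apply: ler_average => v.
have a0 : 0 <= coset_average (f i) W v.
  by apply: average_ge0 => w; case/andP: (f01 i (v + w *m W)).
have a1 : coset_average (f i) W v <= 1.
  rewrite -[X in _ <= X](average_cst (0 : 'rV[F]_n)); apply: ler_average => w.
  by case/andP: (f01 i (v + w *m W)).
by rewrite expr_le1.
Qed.

End Energy.
End Cosets.

(* Each failure of stability raises [Q] by [e], so at most [J] steps are made. *)
Lemma energy_stable_aux (R : realFieldType) (e M : R) (g : nat -> nat) (J k : nat) : 0 <= e ->
  exists B, forall (T : Type) (Q : T -> R) (P : nat -> T -> Prop),
    (forall t, Q t <= M) ->
    forall t, P k t -> M - J%:R * e <= Q t ->
    exists k' t', [/\ (k' <= B)%N, P k' t' &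
      forall t'', P (g k') t'' -> Q t'' <= Q t' + e].
Proof.
move=> e0; elim: J k => [|J IH] k.
  exists k => T Q P QM t Pt Mt; exists k, t; split=> // t'' _.
  by move: Mt; rewrite mul0r subr0; have := QM t''; lra.
have [B HB] := IH (g k); exists (maxn k B) => T Q P QM t Pt Mt.
have [st|] := pselect (forall t'', P (g k) t'' -> Q t'' <= Q t + e).
  by exists k, t; rewrite leq_maxl.
move=> /existsNP[t' /not_implyP[Pt' /negP]]; rewrite -ltNge => Qt'.
have [|k' [s [kB Ps st]]] := HB T Q P QM t' Pt'.
  by move: Mt; rewrite -natr1; lra.
by exists k', s; rewrite leq_max kB orbT.
Qed.

(** [J] is so large that [M - J%:R * e] is negative, hence any start qualifies. [B] is fixed before
    [T], [Q] and [P], which makes the later bounds independent of [n]. *)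
Lemma energy_stable (R : realType) (e M : R) (g : nat -> nat) (k : nat) : 0 < e ->
  exists B, forall (T : Type) (Q : T -> R) (P : nat -> T -> Prop),
    (forall t, 0 <= Q t <= M) -> (exists t, P k t) ->
    exists k' t, [/\ (k' <= B)%N, P k' t &
      forall t', P (g k') t' -> Q t' <= Q t + e].
Proof.
move=> e0; have [B HB] := energy_stable_aux M g (Num.truncn (M / e)).+1 k (ltW e0).
exists B => T Q P QM [t Pt]; apply: HB Pt _ => [s|]; first by case/andP: (QM s).
have /andP[Q0 _] := QM t; apply: le_trans Q0.
by rewrite subr_le0 -ler_pdivrMr // ltW // truncnS_gt.
Qed.

(** * Regularity *)

Section Regularity.
Variables (R : realType) (F : finFieldType).
Local Notation q := (#|F|).

Lemma card_field_gt0 : (0 < q)%N.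
Proof. by apply/card_gt0P; exists 0. Qed.

(** [D *m X] runs over the subspaces of the row space of [X] of codimension at most [K] in it. The
    boolean form lets an average count irregular cosets. *)
Definition regular n (I : finType) (f : I -> 'rV[F]_n -> R) (K : nat) (eta : R)
    (X : 'M_n) (v : 'rV_n) : bool :=
  [forall i, forall D : 'M[F]_n, forall u : 'rV[F]_n, (codim D <= K)%N ==>
    (`|coset_average (f i) (D *m X) (v + u *m X) - coset_average (f i) X v|
       <= eta)].

Lemma regularP n (I : finType) (f : I -> 'rV[F]_n -> R) K eta X v :
  reflect (forall i (D : 'M_n) (u : 'rV_n), (codim D <= K)%N ->
    `|coset_average (f i) (D *m X) (v + u *m X) - coset_average (f i) X v|
       <= eta) (regular f K eta X v).
Proof.
apply: (iffP forallP) => [reg i D u|reg i].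
  by move/forallP/(_ D)/forallP/(_ u)/implyP: (reg i).
by apply/forallP=> D; apply/forallP=> u; apply/implyP; apply: reg.
Qed.

Lemma regular_shift n (I : finType) (f : I -> 'rV[F]_n -> R) K eta X v u :
  regular f K eta X (v + u *m X) = regular f K eta X v.
Proof.
have imp v' u' : regular f K eta X v' -> regular f K eta X (v' + u' *m X).
  move=> /regularP reg; apply/regularP => i D w DK.
  by rewrite coset_average_shift -addrA -mulmxDl; apply: reg.
apply/idP/idP => [reg|]; last exact: imp.
by rewrite -[v](addrK (u *m X)) -mulNmx; apply: imp.
Qed.

(* Jensen's inequality replaces [E] by the larger [D]; the [D]-coset of [u] then
   carries a proportion at least [q ^- K] of the average. *)
Lemma local_energy_gain n (f : 'rV[F]_n -> R) K (D E X : 'M_n) (v u : 'rV_n) :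
  (E <= D)%MS -> (codim D <= K)%N ->
  (coset_average f (D *m X) (v + u *m X) - coset_average f X v) ^+ 2
     / q%:R ^+ K <=
  coset_average (fun x => (coset_average f (E *m X) x - coset_average f X x) ^+ 2)
    X v.
Proof.
move=> /submxP[T ->] DK; set m := coset_average f X v.
pose h w := (coset_average f (D *m X) (v + w *m X) - m) ^+ 2.
pose h' w := (coset_average f (T *m D *m X) (v + w *m X) - m) ^+ 2.
have hD : coset_average h D u = h u.
  rewrite -[RHS](average_cst (0 : 'rV[F]_n)); apply: eq_average => w.
  by rewrite /h mulmxDl addrA -mulmxA coset_average_shift.
have h0 w : 0 <= h w by rewrite sqr_ge0.
rewrite -/(h u) -hD; apply: le_trans (average_ge_coset u DK h0) _.
have -> : coset_average (fun x =>
    (coset_average f (T *m D *m X) x - coset_average f X x) ^+ 2) X v = average h'.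
  by apply: eq_average => w; rewrite /h' coset_average_shift.
rewrite -(average_coset_average h' D); apply: ler_average => w.
have -> : h w = average (fun w' => coset_average f (T *m D *m X)
    (v + w *m X + w' *m (D *m X)) - m) ^+ 2.
  by rewrite averageB average_cst; [rewrite -mulmxA coset_average_mul | exact: 0].
apply: le_trans (average_sqr (0 : 'rV[F]_n) _) _; apply: ler_average => w'.
by rewrite /h' mulmxDl mulmxA addrA.
Qed.

Lemma regularity (N K : nat) (eta theta : R) : 0 < eta -> 0 < theta ->
  exists B, forall n (I : finType) (f : I -> 'rV[F]_n -> R),
    (#|I| <= N)%N -> (forall i v, 0 <= f i v <= 1) ->
    exists2 X : 'M[F]_n, (codim X <= B)%N &
      average (fun v => (~~ regular f K eta X v)%:R) <= theta.
Proof.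
(* If a proportion above [theta] were irregular, each such coset contributing at least
   [eta ^+ 2 / q%:R ^+ K] by [local_energy_gain], the energy would rise by more than [e]. *)
move=> eta0 theta0; pose e := theta * (eta ^+ 2 / q%:R ^+ K).
have qK0 : 0 < q%:R ^+ K :> R by rewrite exprn_gt0 ?ltr0n ?card_field_gt0.
have e0 : 0 < e by rewrite mulr_gt0 // divr_gt0 // exprn_gt0.
(* The step function bounds the codimension reached by intersecting, inside [X], one witness of
   codimension [K] for each of at most [q ^ k] cosets. *)
have [B HB] := energy_stable N%:R (fun k => q ^ k * K + k)%N 0 e0.
exists B => n I f IN f01.
pose P k (X : 'M[F]_n) : Prop := (codim X <= k)%N.
have [X||k [X [kB Xk st]]] := HB _ (energy f) P.
- rewrite sumr_ge0 /= => [|i _].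
    by apply: le_trans (energy_le_card X f01) _; rewrite ler_nat.
  by apply: average_ge0 => v; rewrite sqr_ge0.
- by exists 1%:M; rewrite /P /codim mxrank1 subnn.
exists X; first exact: leq_trans Xk kB.
rewrite leNgt; apply/negP => irr.
have [C [S [SC XC secP]]] := coset_section X.
have /choice[D HD] (a : 'rV[F]_(codim X)) : exists D : 'M[F]_n,
    (codim D <= K)%N /\ (~~ regular f K eta X (a *m S) -> exists i u,
     eta < `|coset_average (f i) (D *m X) (a *m S + u *m X)
             - coset_average (f i) X (a *m S)|).
  have [reg|] := boolP (regular f K eta X (a *m S)).
    by exists 1%:M; split=> //; rewrite /codim mxrank1 subnn.
  case/forallPn=> i /forallPn[D /forallPn[u]].
  rewrite negb_imply -ltNge => /andP[DK dev].
  by exists D; split=> // _; exists i, u.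
pose E := (\bigcap_a D a)%MS.
have EX : P (q ^ k * K + k)%N (E *m X).
  apply: leq_trans (codim_mul _ _) _; apply: leq_add => //.
  apply: leq_trans (codim_bigcap _) _.
  apply: leq_trans (leq_sum _ (fun a _ => (HD a).1)) _.
  rewrite sum_nat_const card_mx mul1n leq_mul2r leq_pexp2l ?orbT //.
  exact: card_field_gt0.
have := st _ EX; apply/negP; rewrite -ltNge addrC -ltrBDr.
rewrite energy_gain -average_sum (average_by_label SC secP).
rewrite (average_by_label SC secP) in irr.
apply: lt_le_trans (_ : e < average (fun a : 'rV[F]_(codim X) =>
   (eta ^+ 2 / q%:R ^+ K) * (~~ regular f K eta X (a *m S))%:R)) _.
  rewrite averageZ /e mulrC ltr_pM2l; last by rewrite divr_gt0 // exprn_gt0.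
  apply: lt_le_trans irr _; apply: ler_average => a.
  rewrite /coset_average (eq_average (g := fun=> (~~ regular f K eta X (a *m S))%:R)).
    by rewrite average_cst //; exact: 0.
  by move=> w; rewrite regular_shift.
apply: ler_average => a.
have G0 i v : 0 <= (coset_average (f i) (E *m X) v - coset_average (f i) X v) ^+ 2.
  exact: sqr_ge0.
have [reg|/(HD a).2[i [u dev]]] := boolP (regular _ _ _ _ _).
  by rewrite mulr0; apply: average_ge0 => w; apply: sumr_ge0.
rewrite mulr1.
apply: le_trans (_ : _ <= coset_average (fun x =>
  (coset_average (f i) (E *m X) x - coset_average (f i) X x) ^+ 2) X (a *m S)) _.
  apply: le_trans (local_energy_gain (f i) X (a *m S) u _ (HD a).1).
    rewrite ler_pM2r ?invr_gt0 // -[leRHS]real_normK ?num_real //.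
    by rewrite ler_sqr ?nnegrE ?(ltW eta0) // ltW.
  by apply: bigcapmx_inf.
apply: ler_average => w; rewrite (bigD1 i) //= lerDl sumr_ge0 // => j _.
Qed.

(** Codimension at most 1 covers the kernels of all characters, which is what [fourier_le]
    requires. *)
Definition uniform n (eta : R) (f : 'rV[F]_n -> R) : Prop :=
  forall (D : 'M_n) u, (codim D <= 1)%N ->
    `|coset_average f D u - average f| <= eta.

End Regularity.

(** * Fourier coefficients and counting *)

Section Fourier.
Variables (R : realType) (p : nat).
Local Notation F := 'F_p.

Lemma norm_character n (eta x : 'rV[F]_n) : `|character R eta x| = 1.
Proof.
by rewrite /character normc_def /= cos2Dsin2 sqrtr1.
Qed.

Lemma character_ker n (eta u w : 'rV[F]_n) :
  character R eta (u + w *m kermx eta^T) = character R eta u.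
Proof. by rewrite /character mulmxDl -mulmxA mulmx_ker mulmx0 addr0. Qed.

(** The character is constant on cosets of [kermx eta^T], so [g] may first be averaged over them. *)
Lemma fourier_le n (g : 'rV[F]_n -> R) (eta : 'rV[F]_n) (e : R) :
  (forall u, `|coset_average g (kermx eta^T) u| <= e) ->
  `|fourier (fun x => (g x)%:C%C) eta| <= e%:C%C.
Proof.
move=> ge; rewrite /fourier.
have -> : average (fun x => (g x)%:C%C * character R eta x) = average (fun u =>
    character R eta u * (coset_average g (kermx eta^T) u)%:C%C).
  transitivity (average (fun w => average (fun u : 'rV[F]_n =>
     (g (u + w *m kermx eta^T))%:C%C * character R eta (u + w *m kermx eta^T)))).
    rewrite -[LHS](average_cst (0 : 'rV[F]_n)); apply: eq_average => w.
    by rewrite -[LHS](average_shift (w *m kermx eta^T)).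
  rewrite average_exchange; apply: eq_average => u.
  rewrite -[RHS]/(_ * (real_complex R _)) /coset_average /average.
  rewrite fmorph_div rmorph_sum rmorph_nat mulrA mulr_sumr; congr (_ / _).
  by apply: eq_bigr => w _; rewrite character_ker mulrC.
apply: le_trans (average_norm _) _.
rewrite -[leRHS](average_cst (0 : 'rV[F]_n)); apply: ler_average => u.
by rewrite normrM norm_character mul1r normc_def /= expr0n addr0 sqrtr_sqr lecR.
Qed.

Lemma codim_kermx_tr n (eta : 'rV[F]_n) : (codim (kermx eta^T) <= 1)%N.
Proof.
rewrite /codim mxrank_ker mxrank_tr subKn ?rank_leq_col //.
exact: rank_leq_row.
Qed.

(* The [f i] are replaced by their averages one at a time: each replacement puts
   a function without large Fourier coefficient into one slot of [Lambda]. *)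
Lemma counting m l (L : 'M[F]_(m, l)) (beta : R) : complexity1 R L -> 0 < beta ->
  exists2 eta : R, 0 < eta & forall n (f : 'I_m -> 'rV[F]_n -> R),
    (forall i x, 0 <= f i x <= 1) -> (forall i, uniform eta (f i)) ->
    \prod_(i < m) average (f i) - beta <= Lambda L f.
Proof.
(* [m.+1] instead of [m] keeps the error per slot positive when [m = 0]. *)
move=> compl beta0; have bm0 : 0 < beta / m.+1%:R by rewrite divr_gt0.
have [eta eta0 Heta] := compl _ bm0; exists eta => // n f f01 uf.
have af01 i : 0 <= average (f i) <= 1.
  apply/andP; split; first by apply: average_ge0 => x; case/andP: (f01 i x).
  rewrite -[leRHS](average_cst (0 : 'rV[F]_n)); apply: ler_average => x.
  by case/andP: (f01 i x).
pose h k (i : 'I_m) x : R := if (i < k)%N then average (f i) else f i x.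
have step k : (k < m)%N -> Lambda L (h k.+1) - beta / m.+1%:R <= Lambda L (h k).
  move=> km.
  pose i0 := Ordinal km.
  pose G i x := if i == i0 then f i x - average (f i) else h k i x.
  (* Only slot [i0] differs between [h k] and [h k.+1], so multilinearity puts the balanced function
     there. *)
  have GE : Lambda L (h k) - Lambda L (h k.+1) = Lambda L G.
    rewrite /Lambda -averageB; apply: eq_average => x.
    rewrite (bigD1 i0) // [X in _ - X](bigD1 i0) // [RHS](bigD1 i0) //=.
    rewrite /h /G /= ltnn ltnSn eqxx mulrBl; congr (_ * _ - _ * _).
      by apply: eq_bigr => i /negbTE ->.
    apply: eq_bigr => i ii0; rewrite (negbTE ii0) ltnS leq_eqVlt.
    by rewrite -val_eqE /= in ii0; rewrite (negbTE ii0).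
  suff : `|Lambda L G| <= beta / m.+1%:R.
    by rewrite -GE ler_norml lerBlDl lerBrDr addrC => /andP[].
  apply: Heta => [i x|].
    have := f01 i x; have := af01 i; rewrite /G /h.
    by case: ifP => _; [|case: ifP => _]; lra.
  exists i0 => xi; apply: fourier_le => u; rewrite /G eqxx.
  apply: le_trans (uf i0 (kermx xi^T) u (codim_kermx_tr xi)).
  by rewrite /coset_average averageB (average_cst (0 : 'rV[F]_n)).
have ind k : (k <= m)%N -> Lambda L (h k) - k%:R * (beta / m.+1%:R) <= Lambda L (h 0).
  elim: k => [|k IH] km; first by rewrite mul0r subr0.
  by have := IH (ltnW km); have := step k km; rewrite -natr1; lra.
have := ind m (leqnn m).
have -> : Lambda L (h m) = \prod_i average (f i).
  rewrite -[RHS](average_cst ([ffun=> 0] : {ffun 'I_l -> 'rV[F]_n})); apply: eq_average => x.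
  by apply: eq_bigr => i _; rewrite /h ltn_ord.
apply: le_trans; rewrite lerD2l lerN2 mulrA ler_pdivrMr ?ltr0Sn // mulrC.
by rewrite ler_pM2l // ler_nat.
Qed.
End Fourier.

(** * A chain of regular subspaces *)

Section Structure.
Variables (R : realType) (F : finFieldType).
Local Notation q := (#|F|).

(* For [a != 0] the vector [a *m Z] is uniformly distributed when [Z] is: union
   bound for [bad], Markov's inequality for [G]. *)
Lemma sample_linear k n (bad : pred 'rV[F]_n) (G : 'rV[F]_k -> 'rV[F]_n -> R)
    (gamma : R) : 0 < gamma -> (forall a w, 0 <= G a w) ->
  average (fun w => (bad w)%:R) <= (4 * q%:R ^+ k)^-1 :> R ->
  average (fun a => average (G a)) <= gamma ->
  exists Z : 'M_(k, n), (forall a, a != 0 -> ~~ bad (a *m Z)) /\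
    average (fun a => (a != 0)%:R * G a (a *m Z)) <= 4 * gamma.
Proof.
move=> gamma0 G0 bad_le G_le.
have qk0 : 0 < q%:R ^+ k :> R by rewrite exprn_gt0 ?ltr0n ?card_field_gt0.
pose A (Z : 'M[F]_(k, n)) : R := \sum_(a : 'rV_k | a != 0) (bad (a *m Z))%:R.
pose D (Z : 'M[F]_(k, n)) := average (fun a => (a != 0)%:R * G a (a *m Z)).
have A_le : average A <= 4^-1.
  rewrite average_sum.
  rewrite (eq_bigr (fun=> average (fun w => (bad w)%:R))) => [|a a0]; last first.
    exact: (average_row_mulmx (fun w => (bad w)%:R) a0).
  apply: le_trans (_ : _ <= \sum_(a : 'rV[F]_k) (4 * q%:R ^+ k)^-1) _.
    rewrite big_mkcond; apply: ler_sum => a _; case: ifP => // _.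
    by rewrite invr_ge0 mulr_ge0 // ltW.
  by rewrite sumr_const card_mx mul1n -[_ *+ _]mulr_natr natrX invfM mulfVK ?gt_eqF.
have D_le : average D <= gamma.
  apply: le_trans G_le; rewrite average_exchange; apply: ler_average => a.
  rewrite averageZ; have [->|a0] := eqVneq a 0.
    by rewrite mul0r; apply: average_ge0.
  by rewrite mul1r (average_row_mulmx (G a) a0).
(* Both summands average at most [4^-1], so some [Z] has total below 1; then [A Z], a sum of
   indicators, must vanish. *)
have : average (fun Z => A Z + (4 * gamma)^-1 * D Z) < 1.
  rewrite averageD averageZ; apply: le_lt_trans (_ : 4^-1 + 4^-1 < 1); last by lra.
  apply: lerD => //; rewrite mulrC ler_pdivrMr; last by rewrite mulr_gt0.
  by lra.
case/(average_lt_exists (0 : 'M[F]_(k, n))) => Z AD.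
have D0 : 0 <= D Z by apply: average_ge0 => a; rewrite mulr_ge0.
have A0 : 0 <= A Z by apply: sumr_ge0.
have gD : 0 <= (4 * gamma)^-1 * D Z by rewrite mulr_ge0 // invr_ge0 mulr_ge0 // ltW.
exists Z; split=> [a a0|].
  apply/negP => bad_a; have : 1 <= A Z.
    by rewrite /A (bigD1 a) //= bad_a lerDl sumr_ge0.
  by lra.
have : (4 * gamma)^-1 * D Z <= 1 by lra.
by rewrite mulrC ler_pdivrMr ?mul1r // mulr_gt0.
Qed.

Lemma coset_average_affine n (g : 'rV[F]_n -> R) (W X : 'M_n) (b w : 'rV_n) :
  coset_average (fun w => g (b + w *m W)) X w =
  coset_average g (X *m W) (b + w *m W).
Proof. by apply: eq_average => w'; rewrite mulmxDl addrA mulmxA. Qed.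

Definition colour_class n r (phi : 'rV[F]_n -> 'I_r) (c : 'I_r) (v : 'rV_n) : R :=
  (phi v == c)%:R.

Lemma colour_class01 n r (phi : 'rV[F]_n -> 'I_r) c v :
  0 <= colour_class phi c v <= 1.
Proof. by rewrite /colour_class ler0n lern1 leq_b1. Qed.

Lemma codim_pid n k : (k <= n)%N -> codim (pid_mx (n - k) : 'M[F]_n) = k.
Proof. by move=> kn; rewrite /codim rank_pid_mx ?leq_subr // subKn. Qed.

(* The triple [W], [X *m W], [X' *m X *m W] is the chain of subspaces; [a] labels
   the cosets of [W], with [a *m Z *m W] the shift chosen inside the coset [a], and
   [z *m Y *m X *m W] the shifts available inside [X *m W].  The latter preserve
   the densities at [a != 0] because regularity there allows codimension [K3 + 1],
   one more than that of [X']. *)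
Lemma strong_regularity (r N k0 : nat) (eta gamma : R) : 0 < eta -> 0 < gamma ->
  exists B, forall n (phi : 'rV[F]_n -> 'I_r), (k0 <= n)%N ->
  exists k (C : 'M[F]_(n, k)) (S Z : 'M[F]_(k, n)) (Y : 'M[F]_(N, n))
    (W X X' : 'M[F]_n),
  [/\ [/\ (k0 <= k)%N, S *m C = 1%:M, W *m C = 0,
          forall v : 'rV[F]_n, exists w, v = v *m C *m S + w *m W
        & (codim (X' *m X *m W) <= B)%N],
      average (fun a : 'rV[F]_k => (a != 0)%:R * \sum_c
         (coset_average (colour_class phi c) (X *m W) (a *m S + a *m Z *m W)
          - coset_average (colour_class phi c) W (a *m S)) ^+ 2) <= gamma,
      forall (a : 'rV[F]_k) (z : 'rV[F]_N) c, a != 0 ->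
        let f (w : 'rV[F]_n) := colour_class phi c
          (a *m S + a *m Z *m W + z *m Y *m X *m W + w *m (X' *m X *m W)) in
        uniform eta f /\
        `|average f - coset_average (colour_class phi c) (X *m W)
            (a *m S + a *m Z *m W)| <= eta
    & forall (z : 'rV[F]_N) c, z != 0 ->
        uniform eta (fun w : 'rV[F]_n => colour_class phi c
          (z *m Y *m X *m W + w *m (X' *m X *m W)))].
Proof.
move=> eta0 gamma0.
have qk0 k : 0 < q%:R ^+ k :> R by rewrite exprn_gt0 ?ltr0n ?card_field_gt0.
have theta0 k : 0 < (4 * q%:R ^+ k)^-1 :> R by rewrite invr_gt0 mulr_gt0.
(* Constants are fixed from the inside outwards: [K3] for [X'], then [B2] for [X], which has to
   tolerate [K3 + 1], then [B0] for [W]. *)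
have [K3 HK3] := regularity F r 1 eta0 (theta0 N).
have eta20 : 0 < eta / 2 by rewrite divr_gt0.
have /choice[B2 HB2] k := regularity F (q ^ k * r) (K3 + 1) eta20 (theta0 k).
have gamma40 : 0 < gamma / 4 by rewrite divr_gt0.
have [B0 HB0] := energy_stable r%:R (fun k => k + B2 k)%N k0 gamma40.
exists (K3 + \max_(k < B0.+1) (k + B2 k))%N => n phi k0n.
(* The lower bound [k0] keeps the exceptional coset [a = 0] small; the upper bound drives the energy
   iteration. *)
pose P k (W : 'M[F]_n) : Prop := (k0 <= codim W <= k)%N.
have phi01 := colour_class01 phi.
have [W||k [W [kB Wk st]]] := HB0 _ (energy (colour_class phi)) P.
- have := energy_le_card W phi01; rewrite card_ord => ->; rewrite andbT.
  by apply: sumr_ge0 => c _; apply: average_ge0 => v; rewrite sqr_ge0.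
- by exists (pid_mx (n - k0)); rewrite /P codim_pid // leqnn.
have {Wk}[k0W Wk] := andP Wk.
have [C [S [SC WC secP]]] := coset_section W.
(* One function per coset label and colour, so that a single [X] serves all cosets of [W]. *)
pose f (ac : 'rV[F]_(codim W) * 'I_r) w :=
  colour_class phi ac.2 (ac.1 *m S + w *m W).
have f01 ac w : 0 <= f ac w <= 1 by exact: phi01.
have [||X XB irrX] := HB2 k n _ f.
- rewrite card_prod card_mx mul1n card_ord leq_mul2r leq_pexp2l ?orbT //.
  exact: card_field_gt0.
- by [].
have XWB : (codim (X *m W) <= k + B2 k)%N.
  by apply: leq_trans (codim_mul _ _) _; rewrite addnC leq_add.
have XWP : P (k + B2 k)%N (X *m W).
  rewrite /P XWB andbT; apply: leq_trans k0W _.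
  by rewrite /codim leq_sub2l // mxrankM_maxr.
pose G a w := \sum_c (coset_average (f (a, c)) X w - average (f (a, c))) ^+ 2.
have [a w|||Z [regZ GZ]] := sample_linear (bad := fun w =>
    ~~ regular f (K3 + 1) (eta / 2) X w) (G := G) gamma40 _ _ _.
- by apply: sumr_ge0 => c _; rewrite sqr_ge0.
- apply: le_trans irrX _; rewrite lef_pV2 ?posrE ?mulr_gt0 //.
  rewrite ler_pM2l // ler_weXn2l // ler1n; exact: card_field_gt0.
(* [X *m W] is a competitor in the stability of [W], so its energy gain is at most [gamma / 4], and
   this bounds the average of [G]. *)
- have := st _ XWP; rewrite addrC -lerBlDr energy_gain -average_sum.
  rewrite (average_by_label SC secP); apply: le_trans.
  apply: ler_average => a; apply: ler_average => w; apply: ler_sum => c _.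
  by rewrite coset_average_affine coset_average_shift.
pose f3 c w := colour_class phi c (w *m (X *m W)).
have [||X' X'B irrX'] := HK3 n _ f3; first by rewrite card_ord.
  by move=> *; apply: phi01.
(* Inside [X *m W] only irregular cosets have to be avoided, so [G] is taken to be 0. *)
have [||Y [regY _]] := sample_linear (k := N) (bad := fun w =>
    ~~ regular f3 1 eta X' w) (G := fun _ _ => 0) gamma0 _ irrX' _.
- by [].
- by rewrite !(average_cst 0) ltW.
exists (codim W), C, S, Z, Y, W, X, X'; split.
- split=> //; rewrite -mulmxA; apply: leq_trans (codim_mul _ _) _.
  apply: leq_add => //; apply: leq_trans XWB _.
  have kB' : (k < B0.+1)%N by [].
  exact: (leq_bigmax (Ordinal kB')).
- have : 4 * (gamma / 4) = gamma by field.
  move=> <-; apply: le_trans GZ; apply: ler_average => a.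
  apply: ler_wpM2l => //; apply: ler_sum => c _.
  by rewrite coset_average_affine.
- move=> a z c a0 g.
  have /regularP reg := negbNE (regZ a a0).
  (* Uniformity compares two densities, each within [eta / 2] of the density on the coset of
     [X *m W]; [dev1] is the case of the full space. *)
  have dev (D : 'M_n) u : (codim D <= 1)%N -> `|coset_average g D u -
      coset_average (colour_class phi c) (X *m W) (a *m S + a *m Z *m W)| <= eta / 2.
    move=> D1; have DX' : (codim (D *m X') <= K3 + 1)%N.
      by apply: leq_trans (codim_mul _ _) _; rewrite addnC leq_add.
    have := reg (a, c) _ (z *m Y + u *m X') DX'.
    rewrite !coset_average_affine /=; apply: le_trans; rewrite le_eqVlt; apply/predU1P; left.
    congr (`|_ - _|); apply: eq_average => w; rewrite /g; congr (colour_class _ _ _).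
    by rewrite !mulmxDl !mulmxA !addrA.
  have dev1 : `|average g - coset_average (colour_class phi c) (X *m W)
      (a *m S + a *m Z *m W)| <= eta / 2.
    have := dev 1%:M 0; rewrite {1}/codim mxrank1 subnn => /(_ isT).
    apply: le_trans; rewrite le_eqVlt; apply/predU1P; left; congr (`|_ - _|).
    by apply: eq_average => w; rewrite mulmx1 add0r.
  split=> [D u D1|]; last by apply: le_trans dev1 _; lra.
  have := dev D u D1; move: dev1; rewrite !ler_norml; lra.
move=> z c z0 D u D1; have /regularP reg := negbNE (regY z z0).
have := reg c D u D1; apply: le_trans; rewrite le_eqVlt; apply/predU1P; left; congr (`|_ - _|).
  apply: eq_average => w; congr (colour_class _ _ _).
  by rewrite !mulmxDl !mulmxA !addrA.
apply: eq_average => w; congr (colour_class _ _ _).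
by rewrite !mulmxDl !mulmxA.
Qed.

End Structure.

(** * Recolouring *)

Section Recolouring.
Variables (R : realType) (F : finFieldType) (n r : nat).
Variable phi : 'rV[F]_n -> 'I_r.
Local Notation q := (#|F|).
Local Notation density := (fun c => coset_average (@colour_class R F n r phi c)).

Lemma sum_density (W : 'M_n) v : \sum_c density c W v = 1.
Proof.
rewrite -average_sum -[RHS](average_cst (0 : 'rV[F]_n)); apply: eq_average => w.
rewrite (bigD1 (phi (v + w *m W))) //= /colour_class eqxx big1 ?addr0 // => c.
by rewrite eq_sym => /negbTE ->.
Qed.

Lemma popular_colour (W : 'M_n) v : exists c, r%:R^-1 <= density c W v.
Proof.
have r0 : (0 < r)%N by case: (r) (phi 0) => // -[].
apply/existsP; apply: contraT; rewrite negb_exists => /forallP small.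
have : \sum_c density c W v < \sum_(c < r) r%:R^-1.
  apply: ltr_sum => [|c _]; last by rewrite ltNge.
  by apply/hasP; exists (phi 0); rewrite ?mem_index_enum.
by rewrite sum_density sumr_const card_ord -[_ *+ _]mulr_natr mulVf ?ltxx // pnatr_eq0 -lt0n.
Qed.

Variables (k : nat) (C : 'M[F]_(n, k)) (S : 'M[F]_(k, n)) (W : 'M[F]_n).
Hypotheses (SC : S *m C = 1%:M) (WC : W *m C = 0).
Hypothesis secP : forall v : 'rV[F]_n, exists w, v = v *m C *m S + w *m W.

(** A point changes colour only if its old colour is not good on its coset, so the change inside a
    coset is at most the total density of such colours. *)
Lemma recolour (good : 'rV[F]_k -> pred 'I_r) : (forall a, exists c, good a c) ->
  exists phi' : {ffun 'rV[F]_n -> 'I_r}, (forall v, good (v *m C) (phi' v)) /\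
    average (fun v => (phi v != phi' v)%:R) <=
    average (fun a => \sum_(c | ~~ good a c) density c W (a *m S)).
Proof.
move=> /choice[fresh goodF].
exists [ffun v => if good (v *m C) (phi v) then phi v else fresh (v *m C)].
split=> [v|]; first by rewrite ffunE; case: ifP.
rewrite (average_by_label SC secP); apply: ler_average => a.
rewrite -average_sum; apply: ler_average => w.
rewrite ffunE label_coset //; case: ifPn => [_|bad].
  by rewrite eqxx; apply: sumr_ge0 => c _; rewrite /colour_class.
rewrite (bigD1 (phi (a *m S + w *m W))) //= /colour_class eqxx.
by rewrite -[leLHS]addr0 lerD ?sumr_ge0 // ler_nat leq_b1.
Qed.

(** The coset 0 costs at most its own proportion. Elsewhere a removed colour has [d' a c < alpha],
    and expanding the square of [d' a c - d + alpha / 2] bounds its true density [d] by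
    [2 * alpha + alpha^-1 * (d' a c - d) ^+ 2]. *)
Lemma recolour_cost (alpha : R) (c0 : 'I_r) (d' : 'rV[F]_k -> 'I_r -> R) :
  0 < alpha ->
  average (fun a => \sum_(c | ~~ (if a == 0 then c == c0 else alpha <= d' a c))
    density c W (a *m S)) <=
  (q%:R ^+ k)^-1 + 2 * r%:R * alpha + alpha^-1 *
    average (fun a => (a != 0)%:R * \sum_c (d' a c - density c W (a *m S)) ^+ 2).
Proof.
move=> alpha0.
have -> : (q%:R ^+ k)^-1 = average (fun a : 'rV[F]_k => (a == 0)%:R) :> R.
  rewrite /average (bigD1 0) //= eqxx big1 => [|a /negbTE -> //].
  by rewrite addr0 mul1r card_mx mul1n natrX.
rewrite -[2 * _ * _](average_cst (0 : 'rV[F]_k)) -averageZ -!averageD.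
have d0 c a : 0 <= density c W (a *m S) by apply: average_ge0 => w.
apply: ler_average => a; have [->|a0] := eqVneq a 0.
  rewrite mul0r mulr0 addr0; apply: le_trans (_ : _ <= 1) _; last first.
    by rewrite lerDl !mulr_ge0 // ltW.
  rewrite -(sum_density W (0 *m S)) big_mkcond; apply: ler_sum => c _.
  by case: ifP.
rewrite add0r mul1r.
apply: le_trans (_ : _ <= \sum_c (2 * alpha + alpha^-1 *
   (d' a c - density c W (a *m S)) ^+ 2)) _; last first.
  rewrite big_split /= -!mulr_sumr sumr_const card_ord lerD2r.
  by rewrite -[_ *+ r]mulr_natr mulrA mulrAC.
rewrite big_mkcond; apply: ler_sum => c _; case: ifPn => [|_]; last first.
  by rewrite addr_ge0 // mulr_ge0 ?sqr_ge0 ?invr_ge0 // ltW.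
rewrite -ltNge => small; set d := density _ _ _.
have -> : 2 * alpha + alpha^-1 * (d' a c - d) ^+ 2 =
    (2 * alpha ^+ 2 + (d' a c - d) ^+ 2) / alpha by field; rewrite gt_eqF.
rewrite ler_pdivlMr //.
have : 0 <= (alpha - d' a c) * alpha by rewrite mulr_ge0 ?subr_ge0 // ltW.
have := sqr_ge0 (d' a c - d + alpha / 2); have := sqr_ge0 alpha.
by rewrite !expr2; lra.
Qed.

End Recolouring.

(** * Densities of instances along translated subspaces *)

Section Instances.
Variables (R : realType) (p m l n : nat) (L : 'M['F_p]_(m, l)).
Local Notation q := (#|'F_p|).

Lemma linear_formD i (x y : {ffun 'I_l -> 'rV['F_p]_n}) :
  linear_form L i [ffun j => x j + y j] = linear_form L i x + linear_form L i y.
Proof.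
by rewrite -big_split; apply: eq_bigr => j _; rewrite ffunE scalerDr.
Qed.

Lemma linear_form_mulmx n' i (x : {ffun 'I_l -> 'rV['F_p]_n}) (A : 'M_(n, n')) :
  linear_form L i [ffun j => x j *m A] = linear_form L i x *m A.
Proof.
by rewrite mulmx_suml; apply: eq_bigr => j _; rewrite ffunE scalemxAl.
Qed.

Lemma average_prod (g : 'rV['F_p]_n -> R) :
  average (fun x : {ffun 'I_l -> 'rV['F_p]_n} => \prod_j g (x j)) = average g ^+ l.
Proof.
rewrite /average -(bigA_distr_bigA (fun _ : 'I_l => g)) /= prodr_const card_ord expr_div_n.
by rewrite card_ffun card_ord natrX.
Qed.

(** Average over all translations [x] and keep those with every [x j] in [W], a proportion
    [(q%:R ^+ codim W)^-1 ^+ l]; such translations are absorbed by the average over [w]. *)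
Lemma Lambda_ge_coset (f : 'I_m -> 'rV['F_p]_n -> R) (W : 'M_n)
    (t : {ffun 'I_l -> 'rV_n}) k : (forall i x, 0 <= f i x) -> (codim W <= k)%N ->
  Lambda L (fun i w => f i (linear_form L i t + w *m W)) / q%:R ^+ (k * l)
    <= Lambda L f.
Proof.
move=> f0 Wk; have [C [S [SC WC secP]]] := coset_section W.
pose g (x : {ffun 'I_l -> 'rV['F_p]_n}) := \prod_i f i (linear_form L i x).
pose tr (y x : {ffun 'I_l -> 'rV['F_p]_n}) := [ffun j => x j + y j].
pose sc (w : {ffun 'I_l -> 'rV['F_p]_n}) := [ffun j => w j *m W].
have tr_inj y : injective (tr y).
  move=> x x' /ffunP e; apply/ffunP => j; have := e j.
  by rewrite !ffunE => /addIr.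
have g0 x : 0 <= g x by apply: prodr_ge0.
pose A := average (fun w => g (tr (sc w) t)).
have -> : Lambda L (fun i w => f i (linear_form L i t + w *m W)) = A.
  apply: eq_average => w; apply: eq_bigr => i _.
  by rewrite linear_formD linear_form_mulmx.
have A0 : 0 <= A by apply: average_ge0.
have -> : Lambda L f = average (fun x => average (fun w => g (tr (sc w) (tr x t)))).
  rewrite average_exchange -[LHS](average_cst ([ffun=> 0] : {ffun 'I_l -> 'rV['F_p]_n})).
  apply: eq_average => w.
  rewrite -[LHS](average_inj _ (tr_inj (sc w))) -[LHS](average_inj _ (tr_inj t)).
  apply: eq_average => x; congr (g _); apply/ffunP => j.
  by rewrite !ffunE [t j + _]addrC.
pose inW (v : 'rV['F_p]_n) : R := (v *m C == 0)%:R.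
have inWE : average inW = (q%:R ^+ codim W)^-1.
  rewrite (average_mulmx (fun a : 'rV_(codim W) => (a == 0)%:R) SC).
  rewrite /average (bigD1 0) //= eqxx big1 => [|a /negbTE -> //].
  by rewrite addr0 mul1r card_mx mul1n natrX.
have q0 : 0 < q%:R :> R by rewrite ltr0n card_field_gt0.
apply: le_trans (_ : _ <= A * average inW ^+ l) _.
  rewrite ler_wpM2l // inWE exprVn -exprM lef_pV2 ?posrE ?exprn_gt0 //.
  by rewrite ler_weXn2l ?leq_mul2r ?Wk ?orbT // ler1n card_field_gt0.
rewrite -average_prod -averageZ; apply: ler_average => x.
have [/forallP xW|/forallPn[j xjW]] := boolP [forall j, x j *m C == 0]; last first.
  by rewrite (bigD1 j) //= /inW (negbTE xjW) mul0r mulr0; apply: average_ge0.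
rewrite big1 => [|j _]; last by rewrite /inW (eqP (xW j)) eqxx.
have /choice[y xy] j : exists w, x j = w *m W.
  by have [w] := secP (x j); rewrite (eqP (xW j)) mul0mx add0r; exists w.
rewrite mulr1 /A -[leLHS](average_inj _ (tr_inj [ffun j => y j])).
rewrite le_eqVlt; apply/predU1P; left; apply: eq_average => w; congr (g _).
by apply/ffunP => j; rewrite !ffunE xy mulmxDl addrAC addrA.
Qed.

End Instances.

(** Halving [b] makes the inequality strict, so that it contradicts an upper bound [delta] of the
    same form. *)
Lemma pattern_density_gt (R : realType) (p m l r n k : nat) (H : pattern p m l r)
    (phi : {ffun 'rV['F_p]_n -> 'I_r}) (chi : {ffun 'I_m -> 'I_r})
    (t : {ffun 'I_l -> 'rV['F_p]_n}) (W : 'M_n) (b : R) :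
  chi \in patcolourings H -> (codim W <= k)%N -> 0 < b ->
  b <= Lambda (forms H) (fun i w =>
         colour_class R phi (chi i) (linear_form (forms H) i t + w *m W)) ->
  b / 2 / #|'F_p|%:R ^+ (k * l) < pattern_density R H phi.
Proof.
move=> chiH Wk b0 bL; have q0 : 0 < #|'F_p|%:R :> R by rewrite ltr0n card_field_gt0.
apply: lt_le_trans (_ : b / #|'F_p|%:R ^+ (k * l) <= _).
  by rewrite ltr_pM2r ?invr_gt0 ?exprn_gt0 //; lra.
apply: le_trans (_ : _ <= Lambda (forms H) (fun i => colour_class R phi (chi i))) _.
  apply: le_trans (Lambda_ge_coset (forms H) t _ Wk); last by move=> i x; rewrite /colour_class.
  by rewrite ler_pM2r // invr_gt0 exprn_gt0.
rewrite /pattern_density (bigD1 chi) //= lerDl; apply: sumr_ge0 => c _.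
by apply: average_ge0 => x; apply: prodr_ge0.
Qed.

Theorem theorem1p5 (R : realType) (p : nat) (hp : prime p) (eps : R)
    (heps : 0 < eps) (r : nat) (hr : (0 < r)%N) (m l : nat)
    (H : pattern p m l r) (hreg : partition_regular (forms H))
    (hcompl : complexity1 R (forms H)) :
  exists delta : R, 0 < delta /\
    forall (n : nat) (phi : {ffun 'rV['F_p]_n -> 'I_r}),
      pattern_density R H phi <= delta ->
      exists phi' : {ffun 'rV['F_p]_n -> 'I_r},
        #|[set x : 'rV['F_p]_n | phi x != phi' x]|%:R
          <= eps * #|{: 'rV['F_p]_n}|%:R
        /\ pattern_free H phi'.
Proof.
set q := #|'F_p|.
have q0 : 0 < q%:R :> R by rewrite ltr0n card_field_gt0.
(* Partition regularity is applied in dimension [N] itself, an auxiliary space fixed before [n]. *)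
have [N /(_ N (leqnn N)) monoN] := hreg r.
have r0 : 0 < r%:R :> R by rewrite ltr0n.
have r1 : 1 <= r%:R :> R by rewrite ler1n.
(* Each of the three terms of [recolour_cost] is to be at most [eps / 4]. The minimum with 1 gives
   [alpha <= r%:R^-1], so popular colours are good. *)
pose alpha : R := Num.min eps 1 / (8 * r%:R).
have min0 : 0 < Num.min eps 1 by rewrite lt_min heps ltr01.
have alpha0 : 0 < alpha by rewrite divr_gt0 // mulr_gt0.
have ralpha : r%:R * alpha = Num.min eps 1 / 8 by rewrite /alpha; field; rewrite gt_eqF.
have min1 : Num.min eps 1 <= 1 by rewrite ge_min lexx orbT.
have mineps : Num.min eps 1 <= eps by rewrite ge_min lexx.
have alphar : alpha <= r%:R^-1.
  by rewrite -[_^-1]mul1r ler_pdivlMr // mulrC ralpha; lra.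
(* Half of the expected product of densities: the counting error [b] leaves [b]. *)
pose b : R := (alpha / 2) ^+ m / 2.
have alpha20 : 0 < alpha / 2 by rewrite divr_gt0.
have b0 : 0 < b by rewrite divr_gt0 // exprn_gt0.
have b1 : b <= 1.
  rewrite /b; have : (alpha / 2) ^+ m <= 1.
    rewrite exprn_ile1 ?(ltW alpha20) //.
    have : alpha <= r%:R * alpha by rewrite ler_pMl.
    by lra.
  by lra.
have [eta1 eta10 count] := counting hcompl b0.
(* [eta1] serves counting; [alpha / 2] lets a density of [alpha] stay above [alpha / 2] after a
   shift. *)
pose eta := Num.min eta1 (alpha / 2).
have eta0 : 0 < eta by rewrite lt_min eta10.
have eta_eta1 : eta <= eta1 by rewrite ge_min lexx.
have eta_alpha : eta <= alpha / 2 by rewrite ge_min lexx orbT.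
pose gamma := alpha * eps / 4.
have gamma0 : 0 < gamma by apply: divr_gt0 => //; apply: mulr_gt0.
have [k0 k0eps] : exists k0, forall k, (k0 <= k)%N -> (q%:R ^+ k)^-1 <= eps / 4.
  exists (Num.bound (4 / eps)) => k kk0.
  rewrite invf_ple ?posrE ?divr_gt0 ?exprn_gt0 // invf_div.
  apply: le_trans (ltW (upper_nthrootP kk0)) _.
  by rewrite lerXn2r ?nnegrE ?(ltW q0) // ler_nat card_finNzRing_gt1.
have [B HB] := @strong_regularity R 'F_p r N k0 eta gamma eta0 gamma0.
exists (b / 2 / q%:R ^+ ((k0 + B) * l)); split.
  by apply: divr_gt0; [apply: divr_gt0|apply: exprn_gt0].
move=> n phi dens.
(* In small dimension [phi] is already free: with [W = 0] a single instance forces a density above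
   [delta]. *)
have [nk0|k0n] := ltnP n k0.
  exists phi; split.
    rewrite (_ : [set x | _] = set0) ?cards0 ?mulr_ge0 ?(ltW heps) //.
    by apply/setP => x; rewrite !inE eqxx.
  move=> x [chi chiH phix]; move: dens; rewrite leNgt => /negP; apply.
  apply: (@pattern_density_gt _ _ _ _ _ _ _ _ _ chi x 0) => //.
    by apply: leq_trans (leq_subr _ _) _; rewrite (leq_trans (ltnW nk0)) ?leq_addr.
  apply: le_trans b1 _.
  rewrite -[leLHS](average_cst ([ffun=> 0] : {ffun 'I_l -> 'rV['F_p]_n})).
  apply: ler_average => w; rewrite big1 // => i _.
  by rewrite mulmx0 addr0 /colour_class phix eqxx.
have [k [C [S [Z [Y [W [X [X' [[k0k SC WC secP WB] gain regN regZ]]]]]]]]] :=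
  HB n phi k0n.
have /choice[psi popular] (z : 'rV['F_p]_N) := popular_colour R phi (X' *m X *m W)
  (z *m Y *m X *m W).
have [x [x0 xmono]] := monoN [ffun z => psi z].
(* When [m = 0] any colour serves as [c0]. *)
have [c0 psi_x] : exists c0, forall i, psi (linear_form (forms H) i x) = c0.
  case: (pickP (predT : pred 'I_m)) => [i0 _|noI]; last by exists (psi 0) => i; have := noI i.
  exists (psi (linear_form (forms H) i0 x)) => i.
  by have := xmono i i0; rewrite !ffunE.
pose d' a c := coset_average (colour_class R phi c) (X *m W) (a *m S + a *m Z *m W).
pose good (a : 'rV['F_p]_k) : pred 'I_r :=
  fun c => if a == 0 then c == c0 else alpha <= d' a c.
have goodex a : exists c, good a c.
  have [->|a0] := eqVneq a 0; first by exists c0; rewrite /good !eqxx.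
  have [c rc] := popular_colour R phi (X *m W) (a *m S + a *m Z *m W).
  by exists c; rewrite /good (negbTE a0); apply: le_trans rc.
have [phi' [phi'_good cost]] := recolour R phi SC WC secP goodex.
exists phi'; split.
  have -> : #|[set x | phi x != phi' x]|%:R =
      average (fun v => (phi v != phi' v)%:R) * #|{: 'rV['F_p]_n}|%:R :> R.
    rewrite /average mulfVK; last first.
      by rewrite pnatr_eq0 -lt0n; apply/card_gt0P; exists 0.
    by rewrite cardsE -sum1_card natr_sum big_mkcond; apply: eq_bigr => v _; rewrite -mulrb.
  rewrite ler_pM2r; last by rewrite ltr0n; apply/card_gt0P; exists 0.
  apply: le_trans cost _.
  apply: le_trans (recolour_cost phi S W c0 d' alpha0) _.
  have iv0 : 0 <= alpha^-1 by rewrite invr_ge0 ltW.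
  have := k0eps k k0k; have := ler_wpM2l iv0 gain.
  have -> : alpha^-1 * gamma = eps / 4 by rewrite /gamma; field; rewrite gt_eqF.
  move: ralpha; rewrite -mulrA => ->; set A := alpha^-1 * _ => gainA qk.
  by apply: le_trans (lerD (lerD qk (lexx _)) gainA) _; lra.
move=> y [chi chiH phiy]; move: dens; rewrite leNgt => /negP; apply.
pose a i : 'rV_k := linear_form (forms H) i y *m C.
pose z i : 'rV_N := linear_form (forms H) i x.
(* The first summand moves each coset label to its chosen coset, the second shifts by the image of
   [x]; both are linear, so they commute with the forms. *)
pose t : {ffun 'I_l -> 'rV_n} :=
  [ffun j => [ffun j => y j *m (C *m S + C *m Z *m W)] j
             + [ffun j => x j *m (Y *m X *m W)] j].
have tE i : linear_form (forms H) i t =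
    a i *m S + a i *m Z *m W + z i *m Y *m X *m W.
  by rewrite linear_formD !linear_form_mulmx mulmxDr !mulmxA.
pose f i w := colour_class R phi (chi i)
  (linear_form (forms H) i t + w *m (X' *m X *m W)).
have WB' : (codim (X' *m X *m W) <= k0 + B)%N by rewrite (leq_trans WB) ?leq_addl.
apply: (pattern_density_gt (t := t) chiH WB' b0).
have good_chi i : good (a i) (chi i) by rewrite -phiy; apply: phi'_good.
have fP i : uniform eta (f i) /\ alpha / 2 <= average (f i).
  rewrite /f tE; have := good_chi i; rewrite /good.
  (* On the coset 0 recolouring forces [chi i = c0], a popular colour at [z i], which is nonzero.
     Elsewhere the good density [alpha] drops by at most [eta]. *)
  have [-> /eqP chi0|ai0 chi_i] := eqVneq (a i) 0.
    rewrite !mul0mx !add0r; split; first by apply: regZ; apply: x0.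
    have := popular (z i); rewrite psi_x -chi0 => le_pop.
    by apply: le_trans le_pop; lra.
  have [uf] := regN (a i) (z i) (chi i) ai0.
  rewrite ler_norml -/(d' _ _) => /andP[dev _]; split=> //.
  by move: chi_i dev; lra.
apply: le_trans (count n f _ _) => [|i w|i D u D1].
- have : (alpha / 2) ^+ m <= \prod_i average (f i).
    rewrite -[m in _ ^+ m]card_ord -prodr_const; apply: ler_prod => i _.
    by rewrite (ltW alpha20) (fP i).2.
  by rewrite /b; lra.
- exact: colour_class01.
- by apply: le_trans ((fP i).1 D u D1) _.
Qed.
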